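(* Let $S_0, S_1 : [\mathbb{N}]^{\mathbb{N}} \to [\mathbb{N}]^{\mathbb{N}}$ be the maps defined, for $n_0 < n_1 < n_2 < \cdots$, by \[S_0(\{n_0, n_1, n_2, \dots\}) = \{n_1, n_2, n_3, \dots\}, \qquad S_1(\{n_0, n_1, n_2, \dots\}) = \{n_1, n_3, n_5, \dots\}.\] Let $G$ be the graph on $[\mathbb{N}]^{\mathbb{N}}$ determined by $S_0$ and $S_1$, and let $E$ be the connected component equivalence relation of $G$. Then $E$ is $F_\sigma$, i.e. $E$ is a countable union of closed subsets of $[\mathbb{N}]^{\mathbb{N}} \times [\mathbb{N}]^{\mathbb{N}}$.
   Context: $[\mathbb{N}]^{\mathbb{N}}$ is the set of infinite subsets of $\mathbb{N}$, with the Polish topology inherited from $2^{\mathbb{N}}$ via characteristic functions; its elements are identified with their increasing enumerations. The graph $G$ determined by $S_0, S_1$ is the undirected graph on $[\mathbb{N}]^{\mathbb{N}}$ in which $x$ and $x'$ are adjacent iff $x' = S_i(x)$ or $x = S_i(x')$ for some $i \in \{0,1\}$. The connected component equivalence relation $E$ relates $x$ and $y$ iff there is a finite path in $G$ from $x$ to $y$; that is, $E$ is the smallest equivalence relation with $x \mathrel{E} S_i(x)$ for all $x$ and $i \in \{0,1\}$. *)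

(* Defs.v *)
From mathcomp Require Import all_boot all_order all_classical.
From mathcomp Require Import topology cantor borel_hierarchy.

Set Implicit Arguments.
Unset Strict Implicit.
Unset Printing Implicit Defensive.

Local Open Scope classical_set_scope.

Definition infinite_subsets : set cantor_space :=
  [set c | infinite_set [set k : nat | c k]].

(* As a [set_type], [infset] carries the topology induced by the inclusion in
   2^N. *)
Definition infset : topologicalType := set_type infinite_subsets.

Definition elements (x : infset) : set nat := [set k | set_val x k].

Lemma infset_unbounded (x : infset) (m : nat) :
  exists k, (m <= k)%N && set_val x k.
Proof.
have /= cinf := set_mem (valP x).
apply: contrapT => /forallNP H; apply: cinf.
apply: (@sub_finite_set _ _ `I_m) => // k /= ck.
by rewrite ltnNge; apply/negP => mk; apply: (H k); rewrite mk set_valE.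
Qed.

Lemma elements_inj : injective elements.
Proof.
move=> x y xy; apply: val_inj; apply/funext => k.
have := congr1 (fun A : set nat => A k) xy.
by rewrite /elements /= set_valE => e; apply/idP/idP; rewrite e.
Qed.

Definition least_from (x : infset) (m : nat) : nat :=
  ex_minn (infset_unbounded x m).

(* [enum x 0 < enum x 1 < ...] is the increasing enumeration of [x]. *)
Fixpoint enum (x : infset) (i : nat) : nat :=
  if i is j.+1 then least_from x (enum x j).+1 else least_from x 0.

Lemma enum_in (x : infset) (i : nat) : elements x (enum x i).
Proof. by case: i => [|i] /=; rewrite /least_from; case: ex_minnP => k /andP[]. Qed.

Lemma enum_increasing (x : infset) : {homo enum x : i j / (i < j)%N}.
Proof.
apply: homo_ltn; first exact: ltn_trans.
by move=> i /=; rewrite /least_from; case: ex_minnP => k /andP[].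
Qed.

Lemma increasing_ge_id (n : nat -> nat) :
  {homo n : i j / (i < j)%N} -> forall i, (i <= n i)%N.
Proof. by move=> hn; elim=> // i /leq_ltn_trans; apply; apply: hn. Qed.

Lemma range_enum (x : infset) : range (enum x) = elements x.
Proof.
apply/seteqP; split=> [_ [i _ <-]|k xk]; first exact: enum_in.
apply: contrapT => nk.
have lt_k i : (enum x i < k)%N.
  elim: i => [|i IH].
    have : (enum x 0 <= k)%N.
      by rewrite /= /least_from; case: ex_minnP => m _; apply.
    by rewrite leq_eqVlt => /predU1P[e|//]; case: nk; exists 0%N.
  have : (enum x i.+1 <= k)%N.
    by rewrite /= /least_from; case: ex_minnP => m _; apply; rewrite IH.
  by rewrite leq_eqVlt => /predU1P[e|//]; case: nk; exists i.+1.
have := lt_k k.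
by rewrite ltnNge (increasing_ge_id (@enum_increasing x)).
Qed.

Lemma range_infinite (n : nat -> nat) : {homo n : i j / (i < j)%N} ->
  (fun k => `[< range n k >]) \in infinite_subsets.
Proof.
move=> hn; apply/mem_set; rewrite /infinite_subsets /=.
have -> : [set k : nat | `[< range n k >]] = range n.
  by apply/seteqP; split=> k /= /asboolP.
have ninj : injective n.
  move=> i j nij; case: (ltngtP i j) => // /hn; by rewrite nij ltnn.
by rewrite (eq_finite_set (inj_card_eq (in2W ninj))); exact: infinite_nat.
Qed.

(* The infinite set {n 0, n 1, n 2, ...}, for n strictly increasing. *)
Definition of_enum (n : nat -> nat) (hn : {homo n : i j / (i < j)%N}) : infset :=
  SigSub (range_infinite hn).

Lemma elements_of_enum (n : nat -> nat) (hn : {homo n : i j / (i < j)%N}) :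
  elements (of_enum hn) = range n.
Proof.
by apply/seteqP; split=> k; rewrite /elements /= set_valE /= => /asboolP.
Qed.

Lemma shift_increasing (n : nat -> nat) : {homo n : i j / (i < j)%N} ->
  {homo (fun i => n i.+1) : i j / (i < j)%N}.
Proof. by move=> hn i j ij; apply: hn. Qed.

Lemma odd_increasing (n : nat -> nat) : {homo n : i j / (i < j)%N} ->
  {homo (fun i => n i.*2.+1) : i j / (i < j)%N}.
Proof. by move=> hn i j ij; apply: hn; rewrite ltnS ltn_double. Qed.

Definition S0 (x : infset) : infset :=
  of_enum (shift_increasing (@enum_increasing x)).

Definition S1 (x : infset) : infset :=
  of_enum (odd_increasing (@enum_increasing x)).

Lemma enum_unique (x : infset) (n : nat -> nat) :
  {homo n : i j / (i < j)%N} -> range n = elements x -> enum x = n.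
Proof.
move=> hn rn; have he := @enum_increasing x.
have aux (f g : nat -> nat) i : {homo f : i j / (i < j)%N} ->
    {homo g : i j / (i < j)%N} -> range f = range g ->
    (forall j, (j < i)%N -> f j = g j) -> (f i <= g i)%N.
  move=> hf hg fg IH; have : range f (g i) by rewrite fg; exists i.
  case=> j _ fj; rewrite -fj; case: (ltnP j i) => [ji|].
    by move: (fj); rewrite (IH _ ji) => e; have := hg _ _ ji; rewrite e ltnn.
  by rewrite leq_eqVlt => /predU1P[->//|/hf/ltnW].
apply/funext; elim/ltn_ind => i IH; apply/eqP; rewrite eqn_leq.
by rewrite !aux // ?range_enum // => j /IH.
Qed.

Lemma S0_of_enum (n : nat -> nat) (hn : {homo n : i j / (i < j)%N}) :
  elements (S0 (of_enum hn)) = [set n i.+1 | i in setT].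
Proof.
by rewrite elements_of_enum (enum_unique hn) // elements_of_enum.
Qed.

Lemma S1_of_enum (n : nat -> nat) (hn : {homo n : i j / (i < j)%N}) :
  elements (S1 (of_enum hn)) = [set n i.*2.+1 | i in setT].
Proof.
by rewrite elements_of_enum (enum_unique hn) // elements_of_enum.
Qed.

Definition G (x y : infset) : Prop :=
  [\/ y = S0 x, x = S0 y, y = S1 x | x = S1 y].

Definition E (x y : infset) : Prop :=
  exists (n : nat) (p : nat -> infset),
    [/\ p 0%N = x, p n = y & forall i, (i < n)%N -> G (p i) (p i.+1)].

(* Main.v *)
Require Import Defs.
From mathcomp Require Import all_boot all_order all_classical.
From mathcomp Require Import topology cantor borel_hierarchy.

Local Open Scope classical_set_scope.

(** [E] is the union over [n] of the relations [paths n] of being joined by a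
    path of length [n], and each of these is already closed.  This goes by
    induction on [n], adding the last edge of the path.  An edge traversed
    against the direction of [S0] or [S1] amounts to a preimage under [id * S],
    which preserves closed sets as [S] is continuous
    ([closed_preimage_last]).  An edge traversed along that direction amounts
    to an image under [id * S], so what is needed is that [id * S] is a closed
    map ([closed_image_last]), that is, that [S] is proper.

    The space of infinite sets is not compact, but properness comes for free
    from [S z] being a subset of [z].  Suppose that [S z] converges to [y].  In
    the compact space 2^N the sets [z] accumulate at some [c]; every element of
    [y] is eventually in [S z], hence in [z], hence in [c].  So [c] contains
    the infinite set [y], is itself infinite, and no limit escapes to the
    finite sets.  This argument is [closed_proj_superset], where accumulation
    is replaced by the tube lemma for 2^N. *)

Local Notation enum := Defs.enum.

(** * The topology of infinite sets, in terms of membership *)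

Lemma elements_near (x : infset) (k : nat) :
  \forall y \near x, elements y k = elements x k.
Proof.
have cv : continuous (fun y : infset => proj k (set_val y : cantor_space) : bool).
  move=> y; apply: (@continuous_comp _ cantor_space bool set_val (proj k)).
    exact: initial_continuous.
  exact: (@proj_continuous nat (fun=> bool) k).
have : \forall y \near x, proj k (set_val y) = proj k (set_val x).
  exact: (cv x _ (discrete_set1 _)).
by apply: filterS => y /= e; rewrite /elements /=; congr is_true; exact: e.
Qed.

Lemma continuous_elements {T : topologicalType} (f : T -> infset) :
  (forall (t : T) (k : nat),
     \forall t' \near t, elements (f t') k = elements (f t) k) ->
  continuous f.
Proof.
move=> fc; apply: (@continuous_comp_initial _ T cantor_space set_val) => t.
apply/cvg_sup => k A [_ [[W _ <-] /= Wt]] /filterS; apply.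
have := fc t k; apply: filterS => t' /=; rewrite /elements /proj /= => e.
have -> // : (set_val (f t') : cantor_space) k = (set_val (f t) : cantor_space) k.
by apply/idP/idP; rewrite e.
Qed.

Lemma closed_eq_infset {T : topologicalType} (f g : T -> infset) :
  continuous f -> continuous g -> closed [set t | f t = g t].
Proof.
move=> cf cg; rewrite closedE => t /= nt; apply: contrapT => fgt; apply: nt.
have [k fgk] : exists k, elements (f t) k <> elements (g t) k.
  by apply/existsNP => fg; apply/fgt/elements_inj/funext.
near=> t' => fg'; apply: fgk.
have <- : elements (f t') k = elements (f t) k.
  by near: t'; exact: (cf t _ (elements_near (f t) k)).
have <- : elements (g t') k = elements (g t) k.
  by near: t'; exact: (cg t _ (elements_near (g t) k)).
by rewrite fg'.
Unshelve. all: by end_near. Qed.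

(** * Projecting closed sets along the space of infinite sets *)

(** Projecting along a noncompact space does not preserve closedness in
    general.  Here the lower bound [g t] keeps the witnesses [z] away from the
    missing points of the compactification 2^N: a point [c] of 2^N either
    contains [g t], and is then an infinite set, where closedness of [C]
    applies, or omits some element [k] of [g t], which no [z] close to [c] with
    [C (t', z)] can do for [t'] close to [t].  Compactness of 2^N then makes
    the neighbourhood of [t] uniform in [c]. *)
Lemma closed_proj_superset {T : topologicalType} (g : T -> infset)
    (C : set (T * infset)) :
  continuous g -> closed C ->
  (forall t z, C (t, z) -> elements (g t) `<=` elements z) ->
  closed [set t | exists z, C (t, z)].
Proof.
move=> cg clC subC; rewrite closedE => t /= nt; apply: contrapT => Ct; apply: nt.
have /compact_near_coveringP cover := cantor_space_compact.
have := cover T (nbhs t)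
  (fun t' c => forall z, set_val z = c :> cantor_space -> ~ C (t', z)) _.
suff near_c (c : cantor_space) : \forall c' \near c & t' \near t,
    forall z, set_val z = c' :> cantor_space -> ~ C (t', z).
  move=> /(_ _ (fun c _ => near_c c)); apply: filterS => t' Ct' [z Cz].
  exact: (Ct' (set_val z : cantor_space) I z).
have near_coord k : \forall c' \near c, c' k = c k.
  exact: (@proj_continuous nat (fun=> bool) k c _ (discrete_set1 _)).
have [gc|/existsNP[k /not_implyP[gk ck]]] :=
    pselect (forall k, elements (g t) k -> c k).
  have cinf : infinite_subsets c.
    rewrite /infinite_subsets /= => /(sub_finite_set gc).
    exact: (set_mem (valP (g t))).
  pose z0 : infset := SigSub (mem_set cinf).
  have : nbhs (t, z0) (~` C).
    apply: open_nbhs_nbhs; split; first exact: closed_openC.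
    by move=> Cz; apply: Ct; exists z0.
  move=> [[U V] [/= Ut [_ [[W oW <-] Wz] WV]] UVC].
  exists (W, U) => /=.
    by split=> //; apply: open_nbhs_nbhs; split.
  move=> [c' t'] /= [Wc' Ut'] z zc'; apply: (UVC (t', z)); split=> //=.
  by apply: WV; rewrite /= zc'.
exists ([set c' | c' k = c k], [set t' | elements (g t') k = elements (g t) k]).
  split=> /=; first exact: near_coord.
  exact: (cg t _ (elements_near (g t) k)).
move=> [c' t'] /= [ck' gk'] z zc' Cz; apply: ck; rewrite -ck' -zc'.
by apply: (subC _ _ Cz); rewrite gk'.
Qed.

(** * Passing to a subsequence of the enumeration *)

Lemma enum_agree (x y : infset) (m i : nat) :
  (forall k, (k <= m)%N -> elements y k = elements x k) ->
  (enum x i <= m)%N -> enum y i = enum x i.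
Proof.
move=> yx.
have least_agree p : (least_from x p <= m)%N -> least_from y p = least_from x p.
  rewrite /least_from; case: ex_minnP => a /andP[pa xa] mina am.
  case: ex_minnP => b /andP[pb yb] minb; apply/eqP; rewrite eqn_leq.
  have ba : (b <= a)%N.
    by apply: minb; rewrite pa; have := yx _ am; rewrite /elements /= => ->.
  rewrite ba mina // pb /=.
  by have := yx _ (leq_trans ba am); rewrite /elements /= => <-.
elim: i => [|i IH] /= im; first exact: least_agree.
rewrite IH ?least_agree //; apply: leq_trans im; apply: ltnW.
exact: (@enum_increasing x i i.+1).
Qed.

(** The form common to [S0] and [S1], from which both continuity and
    [S x] being a subset of [x] follow. *)
Definition subsequence_map (S : infset -> infset) (h : nat -> nat) :=
  forall x, elements (S x) = range (enum x \o h).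

Lemma S0_subsequence : subsequence_map S0 succn.
Proof. by move=> x; exact: elements_of_enum. Qed.

Lemma S1_subsequence : subsequence_map S1 (fun i => i.*2.+1).
Proof. by move=> x; exact: elements_of_enum. Qed.

Lemma subsequence_sub S h x :
  subsequence_map S h -> elements (S x) `<=` elements x.
Proof. by move=> -> _ [i _ <-]; exact: enum_in. Qed.

Lemma subsequence_agree S h (x y : infset) (k : nat) : subsequence_map S h ->
  (forall j, (j <= k)%N -> elements y j = elements x j) ->
  elements (S x) k -> elements (S y) k.
Proof.
move=> Sh yx; rewrite !Sh => -[i _ /= ik]; exists i => //=; rewrite -[RHS]ik.
by apply: (@enum_agree x y k); rewrite ?ik.
Qed.

(** The elements of [x] up to [k] and their ranks determine whether [k] is in
    [S x]. *)
Lemma subsequence_continuous S h : subsequence_map S h -> continuous S.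
Proof.
move=> Sh; apply: continuous_elements => x k.
have agree := @filter_forall _ _
  (fun j : 'I_k.+1 => [set y | elements y j = elements x j]) (nbhs x) (nbhs_filter x)
  (fun j => elements_near x j).
apply: filterS agree => y yx.
have {}yx j : (j <= k)%N -> elements y j = elements x j.
  by move=> jk; exact: (yx (Ordinal (jk : (j < k.+1)%N))).
by apply/propext; split; apply: (subsequence_agree _ _ _ _ _ Sh) => j /yx.
Qed.

(** * Adding one edge to a path *)

Lemma fst_continuous {X Y : topologicalType} : continuous (@fst X Y).
Proof. by move=> p; exact: cvg_fst. Qed.

Lemma snd_continuous {X Y : topologicalType} : continuous (@snd X Y).
Proof. by move=> p; exact: cvg_snd. Qed.

Lemma pair_continuous {X Y Z : topologicalType} (f : X -> Y) (g : X -> Z) :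
  continuous f -> continuous g -> continuous (fun x => (f x, g x)).
Proof. by move=> cf cg x; apply: cvg_pair; [exact: cf|exact: cg]. Qed.

Lemma comp_continuous {X Y Z : topologicalType} (f : X -> Y) (g : Y -> Z) :
  continuous f -> continuous g -> continuous (fun x => g (f x)).
Proof. by move=> cf cg x; apply: continuous_comp; [exact: cf|exact: cg]. Qed.

Lemma closed_preimage_last {T : topologicalType} (S : infset -> infset)
    (A : set (T * infset)) :
  continuous S -> closed A -> closed [set ty | A (ty.1, S ty.2)].
Proof.
move=> cS; apply: preimage_closed => ty _; apply: pair_continuous.
  exact: fst_continuous.
by apply: comp_continuous cS; exact: snd_continuous.
Qed.

(** The image is the projection of a closed set of triples [((t, y), z)] with
    [y = S z], so that [y] itself is the lower bound on [z] needed to project. *)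
Lemma closed_image_last {T : topologicalType} (S : infset -> infset)
    (A : set (T * infset)) :
  continuous S -> (forall z, elements (S z) `<=` elements z) -> closed A ->
  closed [set ty | exists2 z, A (ty.1, z) & ty.2 = S z].
Proof.
move=> cS subS clA.
pose C := [set q : (T * infset) * infset | A (q.1.1, q.2)] `&`
          [set q : (T * infset) * infset | q.1.2 = S q.2].
have -> : [set ty : T * infset | exists2 z, A (ty.1, z) & ty.2 = S z] =
          [set ty | exists z, C (ty, z)].
  by apply/seteqP; split=> ty /= [z]; [move=> ? ?; exists z | case; exists z].
apply: closed_proj_superset; first exact: snd_continuous.
- apply: closedI.
    apply: preimage_closed clA => q _; apply: pair_continuous.
      by apply: comp_continuous; exact: fst_continuous.
    exact: snd_continuous.
  apply: closed_eq_infset.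
    by apply: comp_continuous; [exact: fst_continuous|exact: snd_continuous].
  by apply: comp_continuous cS; exact: snd_continuous.
- by move=> t z [_ /= ->].
Qed.

Definition paths (n : nat) : set (infset * infset) :=
  [set xy | exists p : nat -> infset,
    [/\ p 0%N = xy.1, p n = xy.2 & forall i, (i < n)%N -> G (p i) (p i.+1)]].

Lemma paths0 : paths 0 = [set xy | xy.1 = xy.2].
Proof.
apply/seteqP; split=> [[x y] [p [/= <- <-]]//|[x y] /= <-].
by exists (fun=> x).
Qed.

Lemma pathsS n : paths n.+1 = [set xy | exists2 z, paths n (xy.1, z) & G z xy.2].
Proof.
apply/seteqP; split=> [[x y] [p [/= px py pG]]|[x y] /= [z [p [/= px pz pG]] zy]].
  exists (p n); last by rewrite -py; exact: pG.
  by exists p; split=> // i /ltnW; exact: pG.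
exists (fun i => if (i <= n)%N then p i else y); split=> //=; first by rewrite ltnn.
move=> i; rewrite ltnS => le_in; rewrite le_in.
case: ltnP => [|n_le_i]; first exact: pG.
by have -> : i = n; [apply/eqP; rewrite eqn_leq le_in|rewrite pz].
Qed.

Lemma closed_paths n : closed (paths n).
Proof.
have cS0 := subsequence_continuous _ _ S0_subsequence.
have cS1 := subsequence_continuous _ _ S1_subsequence.
elim: n => [|n IH].
  rewrite paths0; apply: closed_eq_infset; first exact: fst_continuous.
  exact: snd_continuous.
have -> : paths n.+1 =
    [set xy | exists2 z, paths n (xy.1, z) & xy.2 = S0 z] `|`
    [set xy | paths n (xy.1, S0 xy.2)] `|`
    ([set xy | exists2 z, paths n (xy.1, z) & xy.2 = S1 z] `|`
     [set xy | paths n (xy.1, S1 xy.2)]).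
  rewrite pathsS; apply/seteqP; split=> [[x y] /= [z xz [e|e|e|e]]|[x y] /=].
  - by left; left; exists z.
  - by left; right; rewrite -e.
  - by right; left; exists z.
  - by right; right; rewrite -e.
  move=> [[[z xz e]|xz]|[[z xz e]|xz]].
  - by exists z => //; constructor 1.
  - by exists (S0 y) => //; constructor 2.
  - by exists z => //; constructor 3.
  - by exists (S1 y) => //; constructor 4.
apply: closedU; apply: closedU; try exact: closed_preimage_last.
- by apply: closed_image_last => // z; exact: subsequence_sub S0_subsequence.
- by apply: closed_image_last => // z; exact: subsequence_sub S1_subsequence.
Qed.

Theorem proposition1p5 : Fsigma [set xy : infset * infset | E xy.1 xy.2].
Proof.
exists paths; first exact: closed_paths.
apply/seteqP; split=> [xy [n [p np]]|xy [n _ [p np]]]; exists n => //.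
all: by exists p.
Qed.
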